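(* Let $\Theta$ be a locally compact separable metric space. Let $\{\pi_n\}_n$ be a sequence of proper distributions on $\Theta$ such that $\lim_{n}\pi_n(K)=0$ for every compact set $K\subset\Theta$. Then, for every improper distribution $\pi$ on $\Theta$, there exists a sequence $\{\widetilde\pi_n\}_n$ of proper distributions on $\Theta$ which converges q-vaguely to $\pi$ and which has the same set of FAP limit points as $\{\pi_n\}_n$.
   Context: Measurability is with respect to the Borel $\sigma$-algebra of $\Theta$. A proper distribution is a countably additive probability measure on $\Theta$. A Radon measure is a regular countably additive positive measure that is finite on every compact set; Radon measures are here assumed non-null. An improper distribution is an unbounded Radon measure, i.e. one with infinite total mass. For a measure $\mu$ write $\mu(f)=\int f\,d\mu$. q-vague convergence: let $\mathcal C_K$ be the set of continuous real-valued functions on $\Theta$ with compact support. A sequence $\{\mu_n\}_n$ of Radon measures converges q-vaguely to a Radon measure $\mu$ if there exist scalars $a_n>0$ such that $a_n\mu_n(f)\to\mu(f)$ for every $f\in\mathcal C_K$. FAP: let $\mathcal F_b$ be the set of bounded real-valued measurable functions on $\Theta$. A finitely additive probability (FAP) is a linear functional $\pi$ on $\mathcal F_b$ which is positive ($\pi(f)\ge 0$ if $f\ge 0$) and satisfies $\pi(1)=1$. Each proper distribution is regarded as a FAP via $f\mapsto\int f\,d\pi$. A FAP $\pi$ is a FAP limit point of a sequence $\{\pi_n\}_n$ of FAPs if it is a limit point for the weak$^*$ topology, i.e. for every integer $p\ge1$, all $f_1,\dots,f_p\in\mathcal F_b$ and every $\varepsilon>0$, there are infinitely many $n$ such that $|\pi_n(f_i)-\pi(f_i)|\le\varepsilon$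 for $i=1,\dots,p$. *)

(* Defs.v *)
From HB Require Import structures.
From mathcomp Require Import all_boot all_order all_algebra.
From mathcomp Require Import all_classical all_reals all_analysis.
From mathcomp Require Import measurable_realfun.

Set Implicit Arguments.
Unset Strict Implicit.
Unset Printing Implicit Defensive.

Import Order.TTheory GRing.Theory Num.Theory.
Import numFieldNormedType.Exports.

Local Open Scope classical_set_scope.
Local Open Scope ring_scope.

(* Metric spaces with a distinguished point: the library's measurable types
   are pointed, and a space carrying a probability measure is nonempty. *)
#[short(type="pmetricType")]
HB.structure Definition PMetric (K : numDomainType) :=
  { M of Metric K M & Pointed M }.

Notation borel T := (g_sigma_algebraType (@open T)).

Definition separable (T : topologicalType) :=
  exists2 D : set T, countable D & dense D.

Section bounded_measurable.
Context {d : measure_display} {T : measurableType d} {R : realType}.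

Definition bmfun_pred : {pred T -> R} :=
  mem [set f : T -> R | measurable_fun setT f /\ bounded_fun f].

Lemma bmfun_submod_closed : submod_closed bmfun_pred.
Proof.
split=> [|a f g].
  rewrite inE; split; first exact: measurable_cst.
  exists 0; split; first exact: real0.
  by move=> M M0 x _ /=; rewrite normr0 ltW.
rewrite !inE => -[mf [M1 [_ hf]]] [mg [M2 [_ hg]]]; split.
  apply: measurable_funD => //.
  exact: measurable_funM.
exists (`|a| * (`|M1| + 1) + (`|M2| + 1)); split; first exact: num_real.
move=> M hM x _ /=; apply: (le_trans _ (ltW hM)).
rewrite (le_trans (ler_normD _ _))//; apply: lerD.
  rewrite normrM ler_wpM2l//; apply: hf => //.
  by rewrite (le_lt_trans (ler_norm M1))// ltrDl.
by apply: hg => //; rewrite (le_lt_trans (ler_norm M2))// ltrDl.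
Qed.

HB.instance Definition _ :=
  GRing.isSubmodClosed.Build R (T -> R) bmfun_pred bmfun_submod_closed.

End bounded_measurable.

Section bmfun.
Context {d : measure_display} (T : measurableType d) (R : realType).

Record bmfun := Bmfun {
  bmfun_val :> T -> R;
  bmfunP : bmfun_val \in bmfun_pred }.

HB.instance Definition _ := [isSub for bmfun_val].
HB.instance Definition _ := [Choice of bmfun by <:].
HB.instance Definition _ := [SubChoice_isSubLmodule of bmfun by <:].

Lemma bmfun_cst_subproof (c : R) : (cst c : T -> R) \in bmfun_pred.
Proof.
rewrite inE; split; first exact: measurable_cst.
exists `|c|; split; first exact: num_real.
by move=> M cM x _ /=; exact: ltW.
Qed.

Definition bmfun_cst (c : R) : bmfun := Bmfun (bmfun_cst_subproof c).

(* Finitely additive probabilities, as normalized positive linear functionals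
   on bounded measurable functions. *)
Record fap := Fap {
  fap_fun :> {scalar bmfun};
  fap_ge0 : forall f : bmfun, (forall x, 0 <= f x) -> 0 <= fap_fun f;
  fap1 : fap_fun (bmfun_cst 1) = 1 }.

(* Limit points for the weak-* topology, through its basic neighbourhoods. *)
Definition fap_limit_points (pi_ : nat -> fap) : set fap :=
  [set pi | forall (p : nat) (f : 'I_p -> bmfun) (e : R),
    (0 < p)%N -> 0 < e ->
    infinite_set [set n : nat | forall i, `|pi_ n (f i) - pi (f i)| <= e]].

End bmfun.

Section fap_of_probability.
Context {d : measure_display} {T : measurableType d} {R : realType}.
Variable P : probability T R.

Definition bmfun_mean (f : bmfun T R) : R := \int[P]_x f x.

Lemma bmfun_integrable (f : bmfun T R) :
  P.-integrable setT (EFin \o (f : T -> R)).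
Proof.
have := bmfunP f; rewrite inE => -[mf bf].
apply: measurable_bounded_integrable => //.
exact: le_lt_trans (probability_le1 P measurableT) (ltry _).
Qed.

Lemma bmfun_mean_linear : scalar bmfun_mean.
Proof.
move=> a f g; rewrite /bmfun_mean.
rewrite -RintegralZl//; last exact: bmfun_integrable.
rewrite -RintegralD//; last exact: bmfun_integrable.
exact: (bmfun_integrable (a *: f)).
Qed.

HB.instance Definition _ :=
  GRing.isLinear.Build R (bmfun T R) R *%R bmfun_mean bmfun_mean_linear.

Lemma bmfun_mean_ge0 (f : bmfun T R) :
  (forall x, 0 <= f x) -> 0 <= bmfun_mean f.
Proof. by move=> f0; exact: Rintegral_ge0. Qed.

Lemma bmfun_mean1 : bmfun_mean (bmfun_cst T 1) = 1.
Proof.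
rewrite /bmfun_mean Rintegral_cst// mul1r.
exact: (congr1 fine (probability_setT P)).
Qed.

Definition fap_of_probability : fap T R := Fap bmfun_mean_ge0 bmfun_mean1.

End fap_of_probability.

Section radon.
Context {R : realType} {T : pmetricType R}.
Implicit Types mu : {measure set (borel T) -> \bar R}.

(* Outer regularity by open sets and inner regularity by compact sets, on all
   Borel sets; on a locally compact separable metric space the usual variants
   of regularity of a locally finite Borel measure agree. *)
Definition regular_measure mu :=
  forall A : set (borel T), measurable A ->
    mu A = ereal_inf [set mu U | U in [set U : set T | open U /\ A `<=` U]] /\
    mu A = ereal_sup [set mu K | K in [set K : set T | compact K /\ K `<=` A]].

Definition radon mu :=
  [/\ regular_measure mu,
      forall K : set T, compact K -> (mu K < +oo)%E
    & mu setT != 0%E].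

Definition improper mu := radon mu /\ mu setT = +oo%E.

Definition continuous_compact_support (f : T -> R) :=
  continuous f /\ compact (closure [set x | f x != 0]).

(* The real-valued integral is total; it is the genuine integral here, since
   continuous compactly supported functions are integrable for Radon
   measures. *)
Definition q_vague_cvg (mu_ : nat -> {measure set (borel T) -> \bar R}) mu :=
  [/\ forall n, radon (mu_ n), radon mu
    & exists a : nat -> R, (forall n, 0 < a n) /\
        forall f : T -> R, continuous_compact_support f ->
          a n * \int[mu_ n]_x f x @[n --> \oo] --> \int[mu]_x f x].

End radon.

(* Main.v *)
(* Exhaust T by compact sets K_m and choose k(n) -> oo so slowly that, with
   L_n = K_(k(n)), pi_n(L_n) -> 0.  Replace the restriction of pi_n to L_n by a
   multiple of the restriction of pi to L_n, moving an extra mass of order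
   e_n = 1/(n+1) so that the weight w_n of the new part is positive even when
   pi_n(L_n) = 0:
     pit_n = (1 - e_n) pi_n|~L_n + (w_n / pi(L_n)) pi|L_n.
   A test function supported in L_n gives (pi(L_n) / w_n) pit_n(f) = pi(f)
   exactly, whereas |pit_n(f) - pi_n(f)| <= 2 |f| (e_n + pi_n(L_n)) -> 0 for
   bounded f, so that FAP limit points are unchanged. *)
Require Import Defs.
From HB Require Import structures.
From mathcomp Require Import all_boot all_order all_algebra.
From mathcomp Require Import all_classical all_reals all_analysis.
From mathcomp Require Import measurable_realfun ring.
Import Order.TTheory GRing.Theory Num.Theory.
Import numFieldNormedType.Exports.
Local Open Scope classical_set_scope.
Local Open Scope ring_scope.

(** * Exhaustion of the space by compact sets *)

(** Precompact open balls with centres in a dense sequence and radii [1/(k+1)] form a countable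
    cover. Finite unions of their closures give the exhaustion, since a compact set has a finite
    subcover. *)
Lemma separable_locally_compact_exhaustion (R : realType) (T : pmetricType R) :
  locally_compact [set: T] -> separable T ->
  exists K : nat -> set T, [/\ forall m, compact (K m),
    nondecreasing_seq K &
    forall C, compact C -> exists m, C `<=` K m].
Proof.
move=> lcT [D /pcard_surjP[e De] dD].
pose B (p : nat * nat) : set T := (ball (e p.1) p.2.+1%:R^-1)°.
pose V n : set T := if unpickle n is Some p then
  (if `[< precompact (B p) >] then B p else set0) else set0.
have oV n : open (V n).
  rewrite /V; case: unpickle => [p|]; last exact: open0.
  by case: ifPn => _; [exact: open_interior|exact: open0].
have pV n : compact (closure (V n)).
  rewrite -precompactE /V; case: unpickle => [p|]; last first.
    by rewrite precompactE closure0; exact: compact0.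
  case: ifPn => [/asboolP//|_].
  by rewrite precompactE closure0; exact: compact0.
have covV x : exists n, V n x.
  have [|U xU pU] := lcT x; first by [].
  have /nbhs_ballP[r /= r0 rU] : nbhs x U.
    by move: xU; rewrite within_interior ?interiorT.
  have [k kr] : exists k : nat, k.+1%:R^-1 < r / 2.
    have r20 : 0 < r / 2 by rewrite divr_gt0.
    by have /ltr_add_invr[k] := r20; rewrite add0r; exists k.
  (* The centre [y] lies within half the radius of [x], which makes [x] interior to the chosen ball;
     the radius being below [r / 2], that ball lies in [U] and is precompact. *)
  have [y [yx Dy]] : ((ball x (k.+1%:R^-1 / 2))° `&` D) !=set0.
    apply: dD; last exact: open_interior.
    by exists x; apply: nbhsx_ballx; rewrite divr_gt0.
  have [i _ ei] := De _ Dy.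
  exists (pickle (i, k)); rewrite /V pickleK.
  have BU : B (i, k) `<=` U.
    move=> z /interior_subset /=; rewrite /= ei => yz; apply: rU.
    apply: le_ball (ball_triangle (interior_subset yx) yz).
    by rewrite (splitr r) lerD// ltW// (lt_trans _ kr)//
      ltr_pdivrMr// ltr_pMr ?invr_gt0// ltr1n.
  rewrite asboolT; last by exists U.
  rewrite /B/= ei.
  move: yx => /interior_subset/ball_sym yx; apply/nbhs_ballP.
  exists (k.+1%:R^-1 / 2) => [|z xz] /=; first by rewrite divr_gt0.
  by rewrite (splitr k.+1%:R^-1); exact: ball_triangle xz.
pose K m : set T := \bigcup_(i in `I_m) closure (V i).
exists K; split.
- move=> m; have -> : K m = \big[setU/set0]_(i < m) closure (V i).
    exact: bigcup_mkord.
  exact: bigsetU_compact.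
- move=> m n mn; apply/subsetPset => x [i im Vix].
  by exists i => //=; exact: leq_trans mn.
- move=> C; rewrite compact_cover => /(_ nat setT V)[//|x _|].
    by have [n Vnx] := covV x; exists n.
  (* The successor is there because [K m] collects only the indices below [m]. *)
  move=> D' _ CD'; exists (\max_(i <- finmap.enum_fset D') i).+1.
  move=> x /CD'[i /= iD' Vix].
  exists i => /=; last exact: subset_closure.
  by rewrite ltnS; apply: leq_bigmax_seq.
Qed.

(** * Regularity of finite Borel measures *)

Section borel_regularity.
Context {R : realType} {T : pmetricType R}.

Lemma borel_open (U : set T) : open U -> measurable (U : set (borel T)).
Proof. by move=> oU; exact: sub_sigma_algebra. Qed.

Lemma borel_closed (F : set T) : closed F -> measurable (F : set (borel T)).
Proof.
move=> cF; rewrite -(setCK F); apply: measurableC; apply: borel_open.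
exact: closed_openC.
Qed.

Lemma borel_compact (K : set T) : compact K -> measurable (K : set (borel T)).
Proof.
move=> cK; apply: borel_closed; apply: compact_closed cK.
exact: metric_hausdorff.
Qed.

(** The closed sets are made of the points at distance at least [1/(n+1)] from the complement of
    [U]. *)
Lemma open_bigcup_closed (U : set T) : open U ->
  exists F : nat -> set T, [/\ forall n, closed (F n), nondecreasing_seq F &
    \bigcup_n F n = U].
Proof.
move=> oU.
pose G n : set T := \bigcup_(x in ~` U) (ball x n.+1%:R^-1)°.
exists (fun n => ~` G n); split.
- move=> n; apply: open_closedC; apply: bigcup_open => x _.
  exact: open_interior.
- move=> m n mn; apply/subsetPset; apply: subsetC => y [x Ux xy].
  exists x => //.
  apply: interiorS xy; apply: le_ball.
  by rewrite lef_pV2 ?posrE// ler_nat.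
- apply/seteqP; split=> [y [n _ Gy]|y Uy].
    apply: contrapT => Uy; apply: Gy; exists y => //.
    by apply: nbhsx_ballx; rewrite invr_gt0.
  have /nbhs_ballP[r /= r0 rU] : nbhs y U by exact: open_nbhs_nbhs.
  have /ltr_add_invr[n] := r0; rewrite add0r => nr.
  exists n => // -[x Ux /interior_subset /ball_sym yx]; apply: Ux; apply: rU.
  exact: le_ball (ltW nr) _ yx.
Qed.

Variable mu : {finite_measure set (borel T) -> \bar R}.

(** The sandwich is symmetric under complementation, which outer or inner regularity alone is not;
    this lets the sets having it form a sigma-algebra. *)
Definition closed_open_approx (A : set T) := forall e : R, 0 < e ->
  exists F U : set T, [/\ closed F, open U, F `<=` A, A `<=` U &
    (mu (U `\` F) < e%:E)%E].

(** Continuity from above along the differences, which decrease to the empty set; finiteness of [mu]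
    enters here. *)
Lemma finite_measure_bigcup_approx (F : nat -> set (borel T)) (e : R) :
  (forall n, measurable (F n)) -> nondecreasing_seq F -> 0 < e ->
  exists n, (mu (\bigcup_n F n `\` F n) < e%:E)%E.
Proof.
move=> mF ndF e0; set A := \bigcup_n F n.
have mA : measurable A by exact: bigcup_measurable.
have : mu \o (fun n => A `\` F n) @ \oo --> mu (\bigcap_n (A `\` F n)).
  apply: nonincreasing_cvg_mu.
  - by rewrite ltey_eq fin_num_measure//; exact: measurableD.
  - by move=> n; exact: measurableD.
  - by apply: bigcap_measurable => // n _; exact: measurableD.
  - move=> m n mn; apply/subsetPset; apply: setDS.
    by apply/subsetPset; exact: ndF.
have -> : \bigcap_n (A `\` F n) = set0.
  rewrite -subset0 => x xA; have [[n _ Fx] _] := xA 0%N Logic.I.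
  by have [_] := xA n Logic.I.
rewrite measure0 => cv0.
have /cv0[n _ /(_ n (leqnn n)) An] : nbhs 0%E [set y : \bar R | (y < e%:E)%E].
  by apply: open_nbhs_nbhs; split; [exact: open_ereal_lt_ereal|
    rewrite /= lte_fin].
by exists n.
Qed.

Lemma closed_open_approx_open (U : set T) : open U -> closed_open_approx U.
Proof.
move=> oU e e0; have [F [cF ndF FU]] := open_bigcup_closed _ oU.
have [|n ne] := @finite_measure_bigcup_approx F e _ ndF e0.
  by move=> n; exact: borel_closed.
exists (F n), U; split => //; last by rewrite -{1}FU.
by rewrite -FU; exact: bigcup_sup.
Qed.

Lemma closed_open_approxC (A : set T) :
  closed_open_approx A -> closed_open_approx (~` A).
Proof.
move=> apA e /apA[F [U [cF oU FA AU UFe]]].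
exists (~` U), (~` F); split.
- exact: open_closedC.
- exact: closed_openC.
- exact: subsetC.
- exact: subsetC.
- by rewrite setDE setCK setIC -setDE.
Qed.

(** The outer open sets are all united, at a cost summing to at most [e / 2]. A countable union of
    closed sets need not be closed, so the inner ones are united only up to some [n], at a cost
    below the other [e / 2]. *)
Lemma closed_open_approx_bigcup (A : nat -> set T) :
  (forall n, closed_open_approx (A n)) -> closed_open_approx (\bigcup_n A n).
Proof.
move=> apA e e0; have e20 : 0 < e / 2 by rewrite divr_gt0.
have /choice[FU FUP] n : exists p : set T * set T,
    [/\ closed p.1, open p.2, p.1 `<=` A n, A n `<=` p.2 &
    (mu (p.2 `\` p.1) < (e / 2 / (2 ^ n.+1)%:R)%:E)%E].
  have [|F [U FU]] := apA n (e / 2 / (2 ^ n.+1)%:R); last by exists (F, U).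
  by rewrite divr_gt0// ltr0n expn_gt0.
pose G n : set T := \bigcup_(i in `I_n) (FU i).1.
have cG n : closed (G n).
  by apply: closed_bigcup => // i _; have [] := FUP i.
have ndG : nondecreasing_seq G.
  move=> m n mn; apply/subsetPset => x [i im Fix].
  by exists i => //=; exact: leq_trans mn.
have mFU n : measurable ((FU n).2 `\` (FU n).1 : set (borel T)).
  by have [cF oU _ _ _] := FUP n; apply: measurableD;
    [exact: borel_open|exact: borel_closed].
have mG n : measurable (G n : set (borel T)) by exact: borel_closed.
have [n Gn] := finite_measure_bigcup_approx G _ mG ndG e20.
have oU : open (\bigcup_n (FU n).2).
  by apply: bigcup_open => i _; have [] := FUP i.
exists (G n), (\bigcup_n (FU n).2); split => //.
- by move=> x [i _ Fix]; exists i => //; have [_ _ + _ _] := FUP i; apply.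
- by move=> x [i _ Aix]; exists i => //; have [_ _ _ + _] := FUP i; apply.
pose S : set (borel T) := \bigcup_n ((FU n).2 `\` (FU n).1).
have mS : measurable S by exact: bigcup_measurable.
have mGn : measurable (\bigcup_n G n `\` G n : set (borel T)).
  by apply: measurableD => //; exact: bigcup_measurable.
have Se : (mu S <= (e / 2)%:E)%E.
  apply: (@le_trans _ _ (\sum_(i <oo) mu ((FU i).2 `\` (FU i).1))%E).
    exact: measure_sigma_subadditive.
  apply: le_trans (epsilon_trick0 xpredT (ltW e20)).
  by apply: lee_nneseries => // i _; have [_ _ _ _ /ltW] := FUP i.
apply: (@le_lt_trans _ _ (mu (S `|` (\bigcup_n G n `\` G n)))).
  apply: le_measure; rewrite ?inE.
  - by apply: measurableD => //; exact: borel_open.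
  - exact: measurableU.
  (* A point of [(FU i).2] lies either in the gap of index [i] or in [(FU i).1], which enters [G] at
     index [i.+1]. *)
  - move=> x [[i _ Uix] Gx].
    have [Fix|Fix] := pselect ((FU i).1 x); last by left; exists i.
    by right; split => //; exists i.+1 => //; exists i => /=.
apply: le_lt_trans (measureU2 _ mS mGn) _.
by rewrite (splitr e) EFinD lee_ltD// fin_num_measure.
Qed.

Lemma measurable_closed_open_approx (A : set (borel T)) :
  measurable A -> closed_open_approx A.
Proof.
move: A; apply: smallest_sub; last exact: closed_open_approx_open.
split.
- exact/closed_open_approx_open/open0.
- by move=> A; rewrite setTD; exact: closed_open_approxC.
- exact: closed_open_approx_bigcup.
Qed.

Hypothesis Tsigma : exists K : nat -> set T, [/\ forall n, compact (K n),
  nondecreasing_seq K & \bigcup_n K n = [set: T]].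

(** Intersecting the inner closed set with a large compact set of the exhaustion makes it compact
    and loses mass below [e / 2]. *)
Lemma measurable_compact_open_approx (A : set (borel T)) (e : R) :
  measurable A -> 0 < e -> exists K U : set T,
    [/\ compact K, open U, K `<=` A, A `<=` U & (mu (U `\` K) < e%:E)%E].
Proof.
move=> mA e0; have e20 : 0 < e / 2 by rewrite divr_gt0.
have [F [U [cF oU FA AU UFe]]] := measurable_closed_open_approx _ mA _ e20.
have [K [cK ndK KT]] := Tsigma.
have mK n : measurable (K n : set (borel T)) by exact: borel_compact.
have mU := borel_open _ oU; have mF := borel_closed _ cF.
have [n Kn] := finite_measure_bigcup_approx K _ mK ndK e20.
exists (K n `&` F), U; split => //; first exact: compact_closedI.
  by move=> x [_ /FA].
have mKn : measurable (\bigcup_n K n `\` K n : set (borel T)).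
  by rewrite KT; exact: measurableD.
apply: (@le_lt_trans _ _ (mu ((U `\` F) `|` (\bigcup_n K n `\` K n)))).
  apply: le_measure; rewrite ?inE.
  - by apply: measurableD => //; exact: measurableI.
  - by apply: measurableU => //; exact: measurableD.
  - move=> x [Ux KFx]; have [Fx|Fx] := pselect (F x); last by left.
    by right; rewrite KT; split => // Kx; exact: KFx.
apply: le_lt_trans (measureU2 _ (measurableD mU mF) mKn) _.
by rewrite (splitr e) EFinD lteD.
Qed.

Lemma finite_measure_regular : regular_measure mu.
Proof.
move=> A mA; split; apply/eqP; rewrite eq_le; apply/andP; split.
- apply: le_ereal_inf_tmp => _ [U [oU AU] <-].
  by apply: le_measure; rewrite ?inE//; exact: borel_open.
- apply/lee_addgt0Pr => e e0.
  have [K [U [cK oU KA AU UKe]]] := measurable_compact_open_approx _ _ mA e0.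
  have mU := borel_open _ oU; have mK := borel_compact _ cK.
  apply: (@le_trans _ _ (mu U)); first by apply: ereal_inf_lbound; exists U.
  rewrite -(setDUK AU) (le_trans (measureU2 _ _ _))//; first exact: measurableD.
  rewrite leeD2l// (le_trans _ (ltW UKe))// le_measure ?inE//.
  + exact: measurableD.
  + exact: measurableD.
  + by move=> x [Ux Ax]; split => // /KA.
- apply/lee_addgt0Pr => e e0.
  have [K [U [cK oU KA AU UKe]]] := measurable_compact_open_approx _ _ mA e0.
  have mU := borel_open _ oU; have mK := borel_compact _ cK.
  apply: (@le_trans _ _ (mu K + e%:E)%E); last first.
    by apply: leeD2r; apply: ereal_sup_ubound; exists K.
  rewrite -(setDUK KA) (le_trans (measureU2 _ _ _))//; first exact: measurableD.
  rewrite leeD2l// (le_trans _ (ltW UKe))// le_measure ?inE//.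
  + exact: measurableD.
  + exact: measurableD.
  + by move=> x [/AU Ux Kx].
- apply: ge_ereal_sup => _ [K [cK KA] <-].
  by apply: le_measure; rewrite ?inE//; exact: borel_compact.
Qed.

End borel_regularity.

(** * Comparison of FAP limit points and diagonal choice of indices *)

(** A neighbourhood tests finitely many functions, so past a common rank [u] and [v] differ by at
    most [e / 2] on all of them. Finitely many good indices for [v] would then leave finitely many
    for [u] at tolerance [e / 2]. *)
Lemma fap_limit_points_sub d (T : measurableType d) (R : realType)
    (u v : nat -> fap T R) :
  (forall f : bmfun T R, u n f - v n f @[n --> \oo] --> 0) ->
  fap_limit_points u `<=` fap_limit_points v.
Proof.
move=> uv pi Lu p f e p0 e0; have e20 : 0 < e / 2 by rewrite divr_gt0.
have : \forall n \near \oo, forall i, `|u n (f i) - v n (f i)| <= e / 2.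
  apply: filter_forall => i.
  by have /cvgr0_norm_le := uv (f i); apply.
move=> [N _ uvN]; apply: contra_not (Lu p f (e / 2) p0 e20) => finv.
apply: sub_finite_set (_ : finite_set
  ([set n | forall i, `|v n (f i) - pi (f i)| <= e] `|` `I_N)).
  move=> n un; have [nN|Nn] := ltnP n N; [by right|left => i].
  rewrite -(subrK (u n (f i)) (v n (f i))) -addrA (splitr e).
  rewrite (le_trans (ler_normD _ _))// lerD//.
  by rewrite distrC; exact: uvN.
by rewrite finite_setU; split.
Qed.

Lemma fap_limit_points_eq d (T : measurableType d) (R : realType)
    (u v : nat -> fap T R) :
  (forall f : bmfun T R, u n f - v n f @[n --> \oo] --> 0) ->
  fap_limit_points u = fap_limit_points v.
Proof.
move=> uv; apply/seteqP; split; apply: fap_limit_points_sub => // f.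
rewrite -oppr0; under eq_fun do rewrite -opprB.
exact: cvgN.
Qed.

(** Row [m] is at most [1/(m+1)] in absolute value from rank [N m] on. Taking for [k n] the largest
    [m] whose rank [M m] is reached at [n] makes [k] tend to infinity while staying on rows that are
    already small. *)
Lemma cvg0_diagonal (R : realType) (u : nat -> nat -> R) :
  (forall m, u m n @[n --> \oo] --> 0) ->
  exists k : nat -> nat, k n @[n --> \oo] --> \oo /\
    u (k n) n @[n --> \oo] --> 0.
Proof.
move=> u0.
have /choice[N uN] m :
    exists N, forall n, (N <= n)%N -> `|u m n| <= m.+1%:R^-1.
  have /cvgr0_norm_le/(_ m.+1%:R^-1) := u0 m.
  rewrite invr_gt0 ltr0n => /(_ isT).
  by move=> [N _ uN]; exists N.
pose M m := maxn (N m) m.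
pose k n := (\max_(m < n.+1 | M m <= n) m)%N.
have Mk m n : (M m <= n)%N -> (m <= k n)%N.
  move=> Mmn; have mn : (m < n.+1)%N.
    by rewrite ltnS (leq_trans _ Mmn)// leq_maxr.
  exact: (leq_bigmax_cond (Ordinal mn)).
have Nk n : (M 0 <= n)%N -> (N (k n) <= n)%N.
  move=> M0; rewrite /k.
  (* From [M 0] on, index 0 is admissible, so the maximum is attained at an admissible index and is
     not the default 0 of an empty range. *)
  have [|i /= Min ->] := @eq_bigmax_cond _
      [pred m : 'I_n.+1 | M m <= n]%N (fun m => m).
    by apply/card_gt0P; exists ord0.
  by apply: leq_trans Min; exact: leq_maxl.
exists k; split.
  by move=> P [m _ Pm]; exists (M m) => // n /= /Mk/Pm.
apply/cvgr0Pnorm_le => e e0.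
have /ltr_add_invr[m] := e0; rewrite add0r => me.
exists (maxn (M m) (M 0%N)) => // n /=; rewrite geq_max => /andP[/Mk mk /Nk Nn].
apply: le_trans (uN _ _ Nn) _; rewrite (le_trans _ (ltW me))//.
by rewrite lef_pV2 ?posrE// ler_nat.
Qed.

(** * Grafting a piece of a measure onto a probability *)

Lemma Rintegral_mscale d (T : measurableType d) (R : realType)
    (mu : {measure set T -> \bar R}) (k : {nonneg R}) (D : set T) (f : T -> R) :
  measurable D -> mu.-integrable D (EFin \o f) ->
  \int[mscale k mu]_(x in D) f x = k%:num * \int[mu]_(x in D) f x.
Proof.
move=> mD intf; have mf := measurable_int _ intf.
rewrite /Rintegral -[k%:num]/(fine k%:num%:E) -fineM//; last first.
  exact: (integrable_fin_num mD intf).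
congr fine; rewrite integralE [in RHS]integralE muleBr//; last first.
  apply: fin_num_adde_defl; rewrite fin_numN.
  exact: (integrable_fin_num mD (integrable_funeneg mD intf)).
by congr (_ - _)%E; apply: ge0_integral_mscale => //;
  [exact: measurable_funepos|exact: measurable_funeneg].
Qed.

(* The weight w is what is left of the unit mass; e > 0 keeps it positive when
   P K = 0. *)
Lemma probability_graft d (T : measurableType d) (R : realType)
    (P : probability T R) (mu : {measure set T -> \bar R}) (K : set T) (e : R) :
  measurable K -> 0 < e -> e <= 1 -> (0 < mu K)%E -> (mu K < +oo)%E ->
  exists (w : R) (Q : probability T R),
  [/\ 0 < w, w <= e + fine (P K) & forall f : T -> R,
    P.-integrable setT (EFin \o f) -> mu.-integrable K (EFin \o f) ->
    \int[Q]_x f x = (1 - e) * \int[P]_(x in ~` K) f x +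
                    w / fine (mu K) * \int[mu]_(x in K) f x].
Proof.
move=> mK e0 e1 muK0 muKoo; have mKc := measurableC mK.
have muKE : mu K = (fine (mu K))%:E by rewrite fineK// ge0_fin_numE.
have muKR : 0 < fine (mu K) by rewrite fine_gt0// muK0.
have PKE : P K = (fine (P K))%:E by rewrite fineK// fin_num_measure.
have PK0 : 0 <= fine (P K) by rewrite fine_ge0.
have PK1 : fine (P K) <= 1 by rewrite -lee_fin -PKE probability_le1.
have PCE : P (~` K) = (1 - fine (P K))%:E.
  by rewrite probability_setC// PKE.
have e10 : 0 <= 1 - e by rewrite subr_ge0.
(* With [p = P K] this equals [e + p - e * p], which is at least [e]. *)
pose w := 1 - (1 - e) * (1 - fine (P K)).
have w0 : 0 < w.
  rewrite /w subr_gt0 (@le_lt_trans _ _ (1 - e))//.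
    by rewrite ler_piMr// gerBl.
  by rewrite ltrBlDr ltrDl.
have wle : w <= e + fine (P K).
  rewrite /w mulrBr mulr1 mulrBl mul1r.
  rewrite !opprB [leLHS](_ : _ = e + fine (P K) - e * fine (P K)); last by ring.
  by rewrite gerBl mulr_ge0// ltW.
have c0 : 0 <= w / fine (mu K) by rewrite divr_ge0// ltW.
pose m : {measure set T -> \bar R} := measure_add
  (mscale (NngNum e10) (mrestr P mKc)) (mscale (NngNum c0) (mrestr mu mK)).
have mE A : m A = ((1 - e)%:E * P (A `&` ~` K) +
                   (w / fine (mu K))%:E * mu (A `&` K))%E.
  exact: measure_addE.
have m1 : m setT = 1%E.
  rewrite mE !setTI PCE muKE -!EFinM -EFinD divfK ?gt_eqF// /w.
  by rewrite addrC subrK.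
(* Since [m] has mass 1, normalizing does not change it and only supplies the probability structure;
   [P] is the fallback value for degenerate masses. *)
pose Q : probability T R := mnormalize m P.
have QE A : Q A = m A.
  by rewrite -[Q A]/(mnormalize m P A) /mnormalize m1 eqe oner_eq0/=
    invr1 mule1.
exists w, Q; split => // f intP intmu.
have mf : measurable_fun setT (EFin \o f) := measurable_int _ intP.
have intKc : P.-integrable (~` K) (EFin \o f).
  exact: integrableS intP.
have QKE A : measurable A -> A `<=` K ->
    Q A = mscale (NngNum c0) mu A.
  move=> mA AK; rewrite QE mE (setIidl AK) (_ : A `&` _ = set0).
    by rewrite measure0 mule0 add0e.
  by apply/disjoints_subset; rewrite setCK.
have QKcE A : measurable A -> A `<=` ~` K ->
    Q A = mscale (NngNum e10) P A.
  move=> mA AK; rewrite QE mE (setIidl AK) (_ : A `&` K = set0).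
    by rewrite measure0 mule0 adde0.
  exact/disjoints_subset.
have mabs D : measurable_fun D (fun x => `|(EFin \o f) x|)%E.
  exact/measurable_funTS/measurableT_comp.
have intQ : Q.-integrable setT (EFin \o f).
  apply/integrableP; split => //.
  rewrite -(setUv K) ge0_integral_setU//; last first.
    by apply/disj_setPS; rewrite setICr.
  rewrite (eq_measure_integral _ QKE) (eq_measure_integral _ QKcE).
  rewrite !ge0_integral_mscale//.
  have /integrableP[_ /= ?] := intmu; have /integrableP[_ /= ?] := intKc.
  by apply: lte_add_pinfty; apply: lte_mul_pinfty; rewrite ?lee_fin.
rewrite -(setUv K) Rintegral_setU//; last 2 first.
  by rewrite setUv.
  by apply/disj_setPS; rewrite setICr.
rewrite addrC /Rintegral (eq_measure_integral _ QKE).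
rewrite (eq_measure_integral _ QKcE) -!/(Rintegral _ _ _).
by rewrite !Rintegral_mscale.
Qed.

(** * Bounds for test functions and the Radon property of probabilities *)

Lemma continuous_borel_measurable (R : realType) (T : pmetricType R)
    (f : T -> R) : continuous f -> measurable_fun setT (f : borel T -> R).
Proof.
move=> /continuousP cf; apply: (measurability _ (RGenOInfty.measurableE R)).
move=> _ [_ [x ->] <-]; rewrite setTI; apply: borel_open; apply: cf.
by rewrite set_itvE; exact: open_gt.
Qed.

Lemma continuous_compact_support_bounded (R : realType) (T : pmetricType R)
    (f : T -> R) : continuous_compact_support f -> bounded_fun f.
Proof.
move=> [cf csf]; set S := closure _ in csf.
have [M [Mr fM]] : bounded_set (f @` S).
  apply: compact_bounded; apply: continuous_compact csf.
  exact: continuous_subspaceT.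
(* The maximum with 0 covers points off the support: [M] may be negative when the support is
   empty. *)
exists (Num.max M 0); split; first exact: num_real.
move=> M' MM' x _ /=.
have [->|fx] := eqVneq (f x) 0.
  by rewrite normr0 ltW// (le_lt_trans _ MM')// le_max lexx orbT.
apply: fM; first by rewrite (le_lt_trans _ MM')// le_max lexx.
by exists x => //; exact: subset_closure.
Qed.

Lemma normr_Rintegral_le d (T : measurableType d) (R : realType)
    (mu : {measure set T -> \bar R}) (D : set T) (f : T -> R) (M : R) :
  measurable D -> (mu D < +oo)%E -> mu.-integrable D (EFin \o f) ->
  (forall x, `|f x| <= M) -> `|\int[mu]_(x in D) f x| <= M * fine (mu D).
Proof.
move=> mD muD intf fM; rewrite (le_trans (le_normr_Rintegral _ _))//.
rewrite -Rintegral_cst//; apply: le_Rintegral => //.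
  exact: (integrable_norm intf).
apply: measurable_bounded_integrable => //.
exists `|M|; split; first exact: num_real.
by move=> r Mr x _ /=; exact: ltW.
Qed.

Lemma probability_radon (R : realType) (T : pmetricType R)
    (P : probability (borel T) R) :
  (exists K : nat -> set T, [/\ forall n, compact (K n),
    nondecreasing_seq K & \bigcup_n K n = [set: T]]) -> radon P.
Proof.
move=> Tsigma; split.
- exact: finite_measure_regular.
- move=> C /borel_compact mC.
  by rewrite (le_lt_trans (probability_le1 _ mC))// ltry.
- apply/eqP => P0; have /eqP := etrans (esym (probability_setT P)) P0.
  by rewrite eqe oner_eq0.
Qed.

(** * Construction of the sequence and proof of both properties *)

Theorem theorem1 (R : realType) (T : pmetricType R)
    (Tlc : locally_compact [set: T]) (Tsep : separable T)
    (pi_ : nat -> probability (borel T) R)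
    (pi_K : forall K : set T, compact K ->
      pi_ n K @[n --> \oo] --> 0%E)
    (pi : {measure set (borel T) -> \bar R}) (pi_improper : improper pi) :
  exists pit_ : nat -> probability (borel T) R,
    q_vague_cvg pit_ pi /\
    fap_limit_points (fun n => fap_of_probability (pit_ n)) =
    fap_limit_points (fun n => fap_of_probability (pi_ n)).
Proof.
have [radon_pi piT] := pi_improper; have [_ pi_lty _] := radon_pi.
have [K [cK ndK KC]] := separable_locally_compact_exhaustion _ _ Tlc Tsep.
have mK m : measurable (K m : set (borel T)) by exact: borel_compact.
have KT : \bigcup_n K n = [set: T].
  apply/seteqP; split=> // x _; have [m xKm] := KC _ (@compact_set1 T x).
  by exists m => //; exact: xKm.
(* The masses [pi (K m)] increase to [+oo], hence are eventually positive; shifting the exhaustion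
   by [m0] allows division by them. *)
have [m0 Km0] : exists m0, forall m, (m0 <= m)%N -> (0 < pi (K m))%E.
  have := nondecreasing_cvg_mu mK (bigcup_measurable (fun n _ => mK n)) ndK.
  move=> /(_ R pi); rewrite KT piT => piK.
  have /piK[m0 _ m0P] : nbhs (+oo%E : \bar R) [set y | (0 < y)%E].
    by apply: open_nbhs_nbhs; split; [exact: open_ereal_gt_ereal|exact: ltry].
  by exists m0.
have [k [koo kpi]] : exists k : nat -> nat, k n @[n --> \oo] --> \oo /\
    fine (pi_ n (K (k n + m0))) @[n --> \oo] --> 0.
  apply: (@cvg0_diagonal R (fun m n => fine (pi_ n (K (m + m0)%N)))) => m.
  exact/fine_cvg/pi_K.
pose L n : set (borel T) := K (k n + m0)%N.
have mL n : measurable (L n) by exact: mK.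
have piL0 n : (0 < pi (L n))%E by apply: Km0; exact: leq_addl.
have piLoo n : (pi (L n) < +oo)%E by apply: pi_lty; exact: cK.
pose e n : R := harmonic n.
have e0 n : 0 < e n by exact: harmonic_gt0.
have e1 n : e n <= 1 by rewrite /e/= invf_le1// ler1n.
have /choice[w /choice[Q QP]] n := probability_graft _ _ _ (pi_ n) pi _ _
  (mL n) (e0 n) (e1 n) (piL0 n) (piLoo n).
have int_bounded (f : T -> R) (P : probability (borel T) R) :
    measurable_fun setT (f : borel T -> R) -> bounded_fun f ->
    P.-integrable setT (EFin \o f).
  move=> mf bf; apply: measurable_bounded_integrable => //.
  exact: le_lt_trans (probability_le1 P measurableT) (ltry _).
have int_piL (f : T -> R) n :
    measurable_fun setT (f : borel T -> R) -> bounded_fun f ->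
    pi.-integrable (L n) (EFin \o f).
  move=> mf [M [Mr fM]]; apply: measurable_bounded_integrable => //.
    exact: measurable_funTS.
  by exists M; split => // M' MM' x _; exact: fM.
exists Q; split.
  split => //.
    by move=> n; apply: probability_radon; exists K.
  exists (fun n => fine (pi (L n)) / w n); split.
    by move=> n; have [wn0 _ _] := QP n; rewrite divr_gt0// fine_gt0//
      piL0 piLoo.
  move=> f cf; have [m fKm] := KC _ cf.2.
  (* Once [m <= k n], the support of [f] lies in [L n], and the scalar [pi(L n) / w n] cancels the
     coefficient of the grafted part: the rescaled integral is then exactly that of [pi]. *)
  apply: cvg_near_cst.
  have /koo[N _ kN] : \forall j \near \oo, (m <= j)%N by exists m.
  exists N => // n /kN mkn /=.
  have mf := continuous_borel_measurable _ _ _ cf.1.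
  have bf := continuous_compact_support_bounded _ _ _ cf.
  have fL x : x \notin L n -> f x = 0.
    apply: contraNeq => fx; rewrite inE.
    have KL : K m `<=` L n.
      by apply/subsetPset; apply: ndK; exact: leq_trans (leq_addr _ _).
    exact/KL/fKm/subset_closure.
  have [wn0 _ QnE] := QP n.
  rewrite QnE; [|exact: int_bounded|exact: int_piL].
  rewrite (_ : \int[pi_ n]_(x in ~` L n) f x = 0) ?mulr0 ?add0r; last first.
    rewrite (@eq_Rintegral _ _ _ _ _ (cst 0)); last first.
      by move=> x; rewrite inE => /= xL; rewrite fL// notin_setE.
    by rewrite Rintegral_cst ?mul0r//; exact: measurableC.
  have piLR : 0 < fine (pi (L n)) by rewrite fine_gt0// piL0 piLoo.
  rewrite mulrA mulf_div [w n * _]mulrC divff ?mulf_neq0 ?gt_eqF// mul1r.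
  rewrite Rintegral_mkcond.
  by congr Rintegral; apply/funext => x; rewrite patchE; case: ifPn => // /fL.
apply: fap_limit_points_eq => f.
have := bmfunP f; rewrite inE => -[mf bf].
have [M [_ fM]] := bf.
(* Boundedness only gives the bound for constants strictly above [M], hence the added 1. *)
pose B := `|M| + 1.
have fB x : `|f x| <= B.
  by apply: fM => //; rewrite (le_lt_trans (ler_norm M))// ltrDl.
have B0 : 0 <= B by rewrite addr_ge0.
apply: (@squeeze_cvgr _ _ _ _ (fun n => - (B *+ 2 * (e n + fine (pi_ n (L n)))))
  (fun n => B *+ 2 * (e n + fine (pi_ n (L n))))).
- apply: nearW => n; rewrite -ler_norml.
  have [wn0 wle QnE] := QP n.
  rewrite /= /bmfun_mean QnE; [|exact: int_bounded|exact: int_piL].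
  have intf := int_bounded _ (pi_ n) mf bf.
  have piLR : 0 < fine (pi (L n)) by rewrite fine_gt0// piL0 piLoo.
  have -> : \int[pi_ n]_x f x =
      \int[pi_ n]_(x in L n) f x + \int[pi_ n]_(x in ~` L n) f x.
    rewrite -Rintegral_setU ?setUv//; first exact: measurableC.
    by apply/disj_setPS; rewrite setICr.
  have P_lty A : measurable A -> (pi_ n A < +oo)%E.
    by move=> mA; rewrite (le_lt_trans (probability_le1 _ mA))// ltry.
  have := normr_Rintegral_le _ _ _ _ _ _ _ (mL n)
    (P_lty _ (mL n)) (integrableS measurableT (mL n) (@subsetT _ _) intf) fB.
  have mLc := measurableC (mL n).
  have := normr_Rintegral_le _ _ _ _ _ _ _ mLc
    (P_lty _ mLc) (integrableS measurableT mLc (@subsetT _ _) intf) fB.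
  have := normr_Rintegral_le _ _ _ _ _ _ _ (mL n) (piLoo n)
    (int_piL _ n mf bf) fB.
  have Lc1 : fine (pi_ n (~` L n)) <= 1.
    by rewrite -lee_fin fineK ?probability_le1// fin_num_measure.
  set J := \int[pi]_(x in _) _; set I1 := \int[_]_(x in ~` _) _.
  set I2 := \int[_]_(x in _) _ => JB I1B I2B.
  (* With [p] the mass of [L n] under [pi_ n], the three terms are bounded by [B * (e n + p)],
     [B * p] and [e n * B], which add up to [2 * B * (e n + p)]. *)
  rewrite (_ : _ - _ = w n / fine (pi (L n)) * J - I2 - e n * I1); last by ring.
  rewrite (le_trans (ler_normB _ _))//
    (le_trans (lerD (ler_normB _ _) (lexx _)))//.
  have h1 : `|w n / fine (pi (L n)) * J| <= B * (e n + fine (pi_ n (L n))).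
    have wp0 : 0 <= w n / fine (pi (L n)) by rewrite divr_ge0 ?ltW.
    rewrite normrM (ger0_norm wp0) (le_trans (ler_wpM2l wp0 JB))//.
    by rewrite mulrCA -mulrA mulVf ?gt_eqF// mulr1 ler_wpM2l.
  have h2 : `|e n * I1| <= e n * B.
    rewrite normrM (gtr0_norm (e0 n)) ler_wpM2l ?(ltW (e0 n))//.
    by rewrite (le_trans I1B)// ler_piMr.
  rewrite (_ : B *+ 2 * _ = B * (e n + fine (pi_ n (L n))) +
    B * fine (pi_ n (L n)) + e n * B); last by ring.
  by rewrite !lerD.
- rewrite -oppr0; apply: cvgN; rewrite -(mulr0 (B *+ 2)); apply: cvgMr.
  rewrite -(addr0 0); apply: cvgD kpi; exact: cvg_harmonic.
- rewrite -(mulr0 (B *+ 2)); apply: cvgMr.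
  rewrite -(addr0 0); apply: cvgD kpi; exact: cvg_harmonic.
Qed.
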